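(* Let $\lambda>0$ and consider $(\mathfrak g_4,S_3^\lambda,J)$. For a real number $c$, the identity $\operatorname{Ric}^0=c\operatorname{Id}+D$ holds for some derivation $D$ of $\mathfrak g_4$ (that is, $(\mathfrak g_4,S_3^\lambda,J)$ is a first kind algebraic Ricci soliton associated to $\nabla^0$ with constant $c$) if and only if $c=0$.
   Context: $\mathfrak g_4$ is the real Lie algebra with basis $e_1,e_2,e_3,e_4$ and non-zero brackets (up to skew-symmetry) $[e_1,e_2]=e_3$, $[e_1,e_3]=e_4$. For $\lambda>0$, $S_3^\lambda$ is the Lorentzian inner product $\langle\cdot,\cdot\rangle$ on $\mathfrak g_4$ whose matrix in $(e_1,e_2,e_3,e_4)$ is $\begin{bmatrix}0&0&1&0\\0&1&0&0\\1&0&0&0\\0&0&0&\lambda\end{bmatrix}$. Fix the basis $v_1=e_2$, $v_2=\frac1{\sqrt\lambda}e_4$, $v_3=\frac1{\sqrt2}(e_1+e_3)$, $v_4=\frac1{\sqrt2}(e_1-e_3)$, which is orthonormal: $\langle v_i,v_j\rangle=0$ for $i\ne j$, $\langle v_i,v_i\rangle=1$ for $i=1,2,3$, $\langle v_4,v_4\rangle=-1$. The product structure $J$ is the linear map with $Jv_i=v_i$ for $i=1,2,3$ and $Jv_4=-v_4$. Write $\mathfrak g$ for the Lie algebra. The Levi-Civita connection is the bilinear map $\nabla:\mathfrak g\times\mathfrak g\to\mathfrak g$ with $2\langle\nabla_uv,w\rangle=\langle[u,v],w\rangle+\langle[w,u],v\rangle+\langle[w,v],u\rangle$ for all $u,v,w$.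 Put $(\nabla_uJ)v=\nabla_u(Jv)-J(\nabla_uv)$. The canonical connection is $\nabla^0_uv=\nabla_uv-\frac12(\nabla_uJ)Jv$. Its curvature is $R^0_{uv}w=\nabla^0_{[u,v]}w-\nabla^0_u\nabla^0_vw+\nabla^0_v\nabla^0_uw$, and its Ricci operator is $\operatorname{Ric}^0(u)=\sum_{k=1}^4\langle v_k,v_k\rangle R^0_{v_ku}v_k$. A derivation of $\mathfrak g$ is a linear map $D:\mathfrak g\to\mathfrak g$ with $[D(u),v]+[u,D(v)]=D[u,v]$ for all $u,v\in\mathfrak g$. *)

(* Defs.v *)
From HB Require Import structures.
From mathcomp Require Import all_boot all_order all_algebra sesquilinear.
From mathcomp Require Import reals.
From mathcomp Require Import ring lra.

Set Implicit Arguments.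
Unset Strict Implicit.
Unset Printing Implicit Defensive.

Import Order.TTheory GRing.Theory Num.Theory.
Local Open Scope ring_scope.

Section MetricLieAlgebra.
Variables (R : realType) (V : lmodType R).
Variables (br : V -> V -> V) (ip : V -> V -> R).

Definition is_levi_civita (nabla : V -> V -> V) : Prop :=
  forall u v w, 2 * ip (nabla u v) w
    = ip (br u v) w + ip (br w u) v + ip (br w v) u.

Definition covJ (nabla : V -> V -> V) (J : V -> V) (u v : V) : V :=
  nabla u (J v) - J (nabla u v).

Definition canonical_connection (nabla : V -> V -> V) (J : V -> V)
    (u v : V) : V :=
  nabla u v - 2^-1 *: covJ nabla J u (J v).

Definition curvature (conn : V -> V -> V) (u v w : V) : V :=
  conn (br u v) w - conn u (conn v w) + conn v (conn u w).

Definition ricci_operator n (frame : 'I_n -> V) (conn : V -> V -> V)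
    (u : V) : V :=
  \sum_(k < n) ip (frame k) (frame k) *: curvature conn (frame k) u (frame k).

Definition is_derivation (D : V -> V) : Prop :=
  forall u v, br (D u) v + br u (D v) = D (br u v).

Definition first_kind_soliton n (frame : 'I_n -> V) (nabla : V -> V -> V)
    (J : V -> V) (c : R) : Prop :=
  exists2 D : {linear V -> V}, is_derivation D &
    forall u, ricci_operator frame (canonical_connection nabla J) u
              = c *: u + D u.

End MetricLieAlgebra.

Section G4.
Variable R : realType.

(* The basis is numbered from 1: it consists of [e 1], [e 2], [e 3], [e 4]. *)
Definition e (k : nat) : 'rV[R]_4 := \row_(j < 4) (j.+1 == k)%:R.

Definition bracket4 (u v : 'rV[R]_4) : 'rV[R]_4 :=
  (u 0 0 * v 0 1 - u 0 1 * v 0 0) *: e 3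
  + (u 0 0 * v 0 2 - u 0 2 * v 0 0) *: e 4.

Definition S3_mx (lam : R) : 'M[R]_4 :=
  \matrix_(i < 4, j < 4)
    nth 0 (nth [::] [:: [:: 0; 0; 1; 0];
                        [:: 0; 1; 0; 0];
                        [:: 1; 0; 0; 0];
                        [:: 0; 0; 0; lam]] i) j.

Definition S3 (lam : R) (u v : 'rV[R]_4) : R :=
  (u *m S3_mx lam *m v^T) 0 0.

(* The frame is numbered from 0: the vector v_k is [frame4 lam (k - 1)]. *)
Definition frame4 (lam : R) (k : 'I_4) : 'rV[R]_4 :=
  nth 0 [:: e 2;
            (Num.sqrt lam)^-1 *: e 4;
            (Num.sqrt 2)^-1 *: (e 1 + e 3);
            (Num.sqrt 2)^-1 *: (e 1 - e 3)] k.

Definition is_product_structure4 (lam : R) (J : 'rV[R]_4 -> 'rV[R]_4) : Prop :=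
  forall k : 'I_4,
    J (frame4 lam k) = (if (k < 3)%N then frame4 lam k else - frame4 lam k).

Lemma bracket4_linearl (v : 'rV[R]_4) : linear (bracket4 ^~ v).
Proof. by move=> a u w; apply/rowP => j; rewrite !mxE; ring. Qed.

Lemma bracket4_alt (u : 'rV[R]_4) : bracket4 u u = 0.
Proof. by apply/rowP => j; rewrite !mxE; ring. Qed.

Lemma bracket4_skew (u v : 'rV[R]_4) : bracket4 u v = - bracket4 v u.
Proof. by apply/rowP => j; rewrite !mxE; ring. Qed.

Lemma bracket4_jacobi (u v w : 'rV[R]_4) :
  bracket4 u (bracket4 v w) + bracket4 v (bracket4 w u)
  + bracket4 w (bracket4 u v) = 0.
Proof. by apply/rowP => j; rewrite !mxE /=; ring. Qed.

Lemma bracket4E (u v : 'rV[R]_4) :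
  (bracket4 u v 0 0 = 0) * (bracket4 u v 0 1 = 0)
  * (bracket4 u v 0 2 = u 0 0 * v 0 1 - u 0 1 * v 0 0)
  * (bracket4 u v 0 3 = u 0 0 * v 0 2 - u 0 2 * v 0 0).
Proof. by do !split; rewrite !mxE /=; ring. Qed.

Lemma bracket4_basis :
  [/\ bracket4 (e 1) (e 2) = e 3, bracket4 (e 1) (e 3) = e 4,
      bracket4 (e 1) (e 4) = 0, bracket4 (e 2) (e 3) = 0
    & bracket4 (e 2) (e 4) = 0 /\ bracket4 (e 3) (e 4) = 0].
Proof. by do ?split; apply/rowP => j; rewrite !mxE /=; ring. Qed.

Lemma S3E (lam : R) (u v : 'rV[R]_4) :
  S3 lam u v = u 0 0 * v 0 2 + u 0 1 * v 0 1 + u 0 2 * v 0 0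
               + lam * (u 0 3 * v 0 3).
Proof.
rewrite /S3 mxE !big_ord_recl big_ord0 !mxE !big_ord_recl !big_ord0 !mxE /=.
have -> : lift ord0 ord0 = 1 :> 'I_4 by apply/val_inj.
have -> : lift ord0 (lift ord0 ord0) = 2 :> 'I_4 by apply/val_inj.
have -> : lift ord0 (lift ord0 (lift ord0 ord0)) = 3 :> 'I_4 by apply/val_inj.
have -> : ord0 = 0 :> 'I_4 by apply/val_inj.
ring.
Qed.

Lemma frame4_orthonormal (lam : R) (i j : 'I_4) : 0 < lam ->
  S3 lam (frame4 lam i) (frame4 lam j)
  = if i == j then (if (i < 3)%N then 1 else -1) else 0.
Proof.
move=> lam_gt0.
have lamE : lam * ((Num.sqrt lam)^-1 * (Num.sqrt lam)^-1) = 1.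
  by rewrite -invfM -expr2 sqr_sqrtr ?ltW// divff// gt_eqF.
have twoE : (Num.sqrt 2)^-1 * (Num.sqrt 2)^-1 = 2^-1 :> R.
  by rewrite -invfM -expr2 sqr_sqrtr// ler0n.
rewrite S3E /frame4.
case: i => -[|[|[|[|//]]]] hi; case: j => -[|[|[|[|//]]]] hj;
  rewrite /= -?val_eqE /= !mxE /=;
  move: lamE twoE; set l := (Num.sqrt lam)^-1; set t := (Num.sqrt 2)^-1;
  by move=> lamE twoE; lra.
Qed.

Lemma S3_nondegenerate (lam : R) (u v : 'rV[R]_4) : 0 < lam ->
  (forall w, S3 lam u w = S3 lam v w) -> u = v.
Proof.
move=> lam_gt0 uv.
have H (k : nat) := uv (e k).
have := H 1%N; have := H 2%N; have := H 3%N; have := H 4%N.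
rewrite !S3E !mxE /= !(mulr0, mulr1, addr0, add0r).
move=> /(mulfI (lt0r_neq0 lam_gt0)) h3 h0 h1 h2.
apply/rowP => -[[|[|[|[|//]]]] hi].
- by rewrite (_ : Ordinal hi = 0) //; apply/val_inj.
- by rewrite (_ : Ordinal hi = 1) //; apply/val_inj.
- by rewrite (_ : Ordinal hi = 2) //; apply/val_inj.
- by rewrite (_ : Ordinal hi = 3) //; apply/val_inj.
Qed.

Lemma frame4_expansion (lam : R) (u : 'rV[R]_4) : 0 < lam ->
  u = \sum_(k < 4)
        (S3 lam (frame4 lam k) (frame4 lam k) * S3 lam u (frame4 lam k))
          *: frame4 lam k.
Proof.
move=> lam_gt0.
have lamE : lam * ((Num.sqrt lam)^-1 * (Num.sqrt lam)^-1) = 1.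
  by rewrite -invfM -expr2 sqr_sqrtr ?ltW// divff// gt_eqF.
have twoE : (Num.sqrt 2)^-1 * (Num.sqrt 2)^-1 = 2^-1 :> R.
  by rewrite -invfM -expr2 sqr_sqrtr// ler0n.
rewrite !big_ord_recl big_ord0 !frame4_orthonormal //= !S3E /frame4.
have := (congr1 ( *%R (u 0 0)) twoE, congr1 ( *%R (u 0 2)) twoE,
  congr1 ( *%R (u 0 3)) lamE).
move: lamE twoE; set l := (Num.sqrt lam)^-1; set t := (Num.sqrt 2)^-1.
move=> _ _ [[two0 two2] lam3].
apply/rowP => -[[|[|[|[|//]]]] hi]; rewrite !mxE /=.
- rewrite (_ : Ordinal hi = 0); [lra | exact/val_inj].
- rewrite (_ : Ordinal hi = 1); [lra | exact/val_inj].
- rewrite (_ : Ordinal hi = 2); [lra | exact/val_inj].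
- rewrite (_ : Ordinal hi = 3); [lra | exact/val_inj].
Qed.

Lemma product_structure4_uniq (lam : R)
    (J J' : {linear 'rV[R]_4 -> 'rV[R]_4}) : 0 < lam ->
  is_product_structure4 lam J -> is_product_structure4 lam J' -> J =1 J'.
Proof.
move=> lam_gt0 hJ hJ' u; rewrite (frame4_expansion u lam_gt0) !linear_sum /=.
by apply: eq_bigr => k _; rewrite !linearZ /= hJ hJ'.
Qed.

(* The product structure exchanges [e 1] and [e 3], since v_3 and v_4 are
   multiples of their sum and difference. *)
Definition J4 (u : 'rV[R]_4) : 'rV[R]_4 :=
  u 0 2 *: e 1 + u 0 1 *: e 2 + u 0 0 *: e 3 + u 0 3 *: e 4.

Fact J4_linear : linear J4.
Proof. by move=> a u v; apply/rowP => j; rewrite !mxE; ring. Qed.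
HB.instance Definition _ :=
  GRing.isLinear.Build R 'rV[R]_4 'rV[R]_4 *:%R J4 J4_linear.

Lemma product_structure4_exists (lam : R) :
  exists J : {linear 'rV[R]_4 -> 'rV[R]_4}, is_product_structure4 lam J.
Proof.
exists J4; rewrite /is_product_structure4 /frame4.
case=> -[|[|[|[|//]]]] hk; apply/rowP => j;
  rewrite /= !mxE /=; ring.
Qed.

Lemma levi_civita4_uniq (lam : R)
    (nabla nabla' : 'rV[R]_4 -> 'rV[R]_4 -> 'rV[R]_4) :
  0 < lam ->
  is_levi_civita bracket4 (S3 lam) nabla ->
  is_levi_civita bracket4 (S3 lam) nabla' -> nabla =2 nabla'.
Proof.
move=> lam_gt0 h h' u v; apply: (S3_nondegenerate lam_gt0) => w.
apply: (@mulfI _ 2); first by rewrite pnatr_eq0.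
by rewrite h h'.
Qed.

Definition koszul4 (lam : R) (u v w : 'rV[R]_4) : R :=
  S3 lam (bracket4 u v) w + S3 lam (bracket4 w u) v + S3 lam (bracket4 w v) u.

(* The basis of [S3 lam]-dual vectors to [e 1], ..., [e 4] is
   [e 3], [e 2], [e 1], [lam^-1 *: e 4]. *)
Definition nabla4 (lam : R) (u v : 'rV[R]_4) : 'rV[R]_4 :=
  2^-1 *: (koszul4 lam u v (e 3) *: e 1 + koszul4 lam u v (e 2) *: e 2
    + koszul4 lam u v (e 1) *: e 3 + (lam^-1 * koszul4 lam u v (e 4)) *: e 4).

Lemma koszul4_linearl (lam : R) (v w : 'rV[R]_4) :
  scalar (fun u => koszul4 lam u v w).
Proof.
move=> a u u'; by rewrite /koszul4 !S3E !bracket4E !mxE; ring.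
Qed.

Lemma koszul4_linearr (lam : R) (u w : 'rV[R]_4) :
  scalar (fun v => koszul4 lam u v w).
Proof.
move=> a v v'; by rewrite /koszul4 !S3E !bracket4E !mxE; ring.
Qed.

Fact nabla4_bilinear (lam : R) : bilinear_for *:%R *:%R (nabla4 lam).
Proof.
split=> w a u v; apply/rowP => j; rewrite /nabla4.
  by rewrite !koszul4_linearl /= !mxE; ring.
by rewrite !koszul4_linearr /= !mxE; ring.
Qed.
HB.instance Definition _ (lam : R) :=
  bilinear_isBilinear.Build R 'rV[R]_4 'rV[R]_4 'rV[R]_4 *:%R *:%R
    (nabla4 lam) (nabla4_bilinear lam).

Lemma levi_civita4_exists (lam : R) : 0 < lam ->
  exists nabla : {bilinear 'rV[R]_4 -> 'rV[R]_4 -> 'rV[R]_4},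
    is_levi_civita bracket4 (S3 lam) nabla.
Proof.
move=> lam_gt0; exists (nabla4 lam) => u v w /=.
have -> : 2 * S3 lam (nabla4 lam u v) w
  = koszul4 lam u v (e 3) * w 0 2 + koszul4 lam u v (e 2) * w 0 1
    + koszul4 lam u v (e 1) * w 0 0 + koszul4 lam u v (e 4) * w 0 3.
  rewrite S3E /nabla4 !mxE /= !(mulr0, mulr1, addr0, add0r).
  by move: (koszul4 _ _ _) => k; field; rewrite gt_eqF.
rewrite /koszul4 !S3E !bracket4E !mxE /= !(mulr0, mul0r, mulr1, mul1r).
ring.
Qed.

End G4.

(* Main.v *)
Require Import Defs.
From HB Require Import structures.
From mathcomp Require Import all_boot all_order all_algebra sesquilinear.
From mathcomp Require Import reals.
From mathcomp Require Import ring lra.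
Import Order.TTheory GRing.Theory Num.Theory.
Local Open Scope ring_scope.

(** Explicitly, [Ric^0 u = - (u_2 / 4) e_4], which is itself a derivation, since
    it maps [e_2] into the centre and kills the derived algebra.  Derivations
    form a vector space, so [Ric^0 = c Id + D] with [D] a derivation exactly when
    [c Id] is a derivation; this forces [c [u, v] = 2 c [u, v]], i.e. [c = 0]. *)

Lemma rowP4 (R : realType) (u v : 'rV[R]_4) :
  u 0 0 = v 0 0 -> u 0 1 = v 0 1 -> u 0 2 = v 0 2 -> u 0 3 = v 0 3 -> u = v.
Proof.
move=> h0 h1 h2 h3; apply/rowP => -[[|[|[|[|//]]]] hi].
- by rewrite (_ : Ordinal hi = 0) //; apply/val_inj.
- by rewrite (_ : Ordinal hi = 1) //; apply/val_inj.
- by rewrite (_ : Ordinal hi = 2) //; apply/val_inj.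
- by rewrite (_ : Ordinal hi = 3) //; apply/val_inj.
Qed.

Lemma J4_product_structure (R : realType) (lam : R) :
  is_product_structure4 lam (@J4 R).
Proof.
by case=> -[|[|[|[|//]]]] hk; apply/rowP => j; rewrite /J4 /frame4 /= !mxE /=; ring.
Qed.

(** By uniqueness, [J] agrees with the explicit [J4], which swaps the coordinates along [e 1] and
    [e 3]. *)
Lemma product_structure4E (R : realType) (lam : R)
    (J : {linear 'rV[R]_4 -> 'rV[R]_4}) (u : 'rV[R]_4) :
  0 < lam -> is_product_structure4 lam J ->
  (J u 0 0 = u 0 2) * (J u 0 1 = u 0 1) * (J u 0 2 = u 0 0) * (J u 0 3 = u 0 3).
Proof.
move=> lam_gt0 hJ.
rewrite !(product_structure4_uniq lam_gt0 hJ (@J4_product_structure R lam)) /=.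
by do !split; rewrite /J4 !mxE /=; ring.
Qed.

(** Pairing with [e 1], [e 2], [e 3], [e 4] reads off coordinates 2, 1, 0 and [lam] times coordinate
    3, so four instances of the Koszul formula determine [nabla u v]. *)
Lemma levi_civita4E (R : realType) (lam : R)
    (nabla : 'rV[R]_4 -> 'rV[R]_4 -> 'rV[R]_4) (u v : 'rV[R]_4) :
  0 < lam -> is_levi_civita (@bracket4 R) (S3 lam) nabla ->
  (nabla u v 0 0 = - (lam / 2) * (u 0 0 * v 0 3 + u 0 3 * v 0 0))
  * (nabla u v 0 1 = - (u 0 0 * v 0 0))
  * (nabla u v 0 2
     = u 0 0 * v 0 1 + lam / 2 * (u 0 2 * v 0 3 + u 0 3 * v 0 2))
  * (nabla u v 0 3 = (u 0 0 * v 0 2 - u 0 2 * v 0 0) / 2).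
Proof.
move=> lam_gt0 /(_ u v) h; have lam0 : lam != 0 by rewrite gt_eqF.
have := (h (@e R 1), h (@e R 2), h (@e R 3), h (@e R 4)).
move: (nabla u v) => n; rewrite !S3E !bracket4E !mxE /=.
move=> [[[h1 h2] h3] h4]; do !split; [lra|lra|lra|].
by apply: (mulfI lam0); lra.
Qed.

Definition ric4 {R : realType} (u : 'rV[R]_4) : 'rV[R]_4 :=
  - (u 0 1 / 4) *: @e R 4.

Fact ric4_linear (R : realType) : linear (@ric4 R).
Proof. by move=> a u v; apply/rowP => j; rewrite !mxE; ring. Qed.
HB.instance Definition _ (R : realType) :=
  GRing.isLinear.Build R 'rV[R]_4 'rV[R]_4 *:%R (@ric4 R) (ric4_linear R).

Lemma ric4_derivation (R : realType) : is_derivation (@bracket4 R) (@ric4 R).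
Proof. by move=> u v; apply: rowP4; rewrite !mxE /=; ring. Qed.

Section CanonicalConnection.
Variables (R : realType) (lam : R) (J : {linear 'rV[R]_4 -> 'rV[R]_4}).
Variable nabla : 'rV[R]_4 -> 'rV[R]_4 -> 'rV[R]_4.
Hypothesis lam_gt0 : 0 < lam.
Hypothesis J_product : is_product_structure4 lam J.
Hypothesis nabla_LC : is_levi_civita (@bracket4 R) (S3 lam) nabla.

Let conn := canonical_connection nabla J.

(** As [J] is an involution, [conn u v] is the mean of [nabla u v] and [J (nabla u (J v))]. In these
    formulas v_4 is parallel and all values lie in the span of v_1, v_2, v_3, whence the equal
    coordinates 0 and 2. *)
Lemma canonical_connection4E (u v : 'rV[R]_4) :
  (conn u v 0 0 = (u 0 0 * v 0 1 + lam / 2 * (u 0 2 - u 0 0) * v 0 3) / 2)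
  * (conn u v 0 1 = - (u 0 0 * (v 0 0 + v 0 2) / 2))
  * (conn u v 0 2 = (u 0 0 * v 0 1 + lam / 2 * (u 0 2 - u 0 0) * v 0 3) / 2)
  * (conn u v 0 3 = - ((u 0 2 - u 0 0) * (v 0 0 + v 0 2) / 4)).
Proof.
have JE x := product_structure4E _ _ _ x lam_gt0 J_product.
have NE x y := levi_civita4E _ _ _ x y lam_gt0 nabla_LC.
have connE j : conn u v 0 j
    = nabla u v 0 j - 2^-1 * (nabla u (J (J v)) 0 j - J (nabla u (J v)) 0 j).
  rewrite /conn /canonical_connection /covJ.
  by move: (nabla u v) (nabla _ _) (J (nabla _ _)) => x y z; rewrite !mxE.
by rewrite !connE !JE !NE !JE; do !split; field.
Qed.

(** The scalar factors are a quarter of the coordinates of [bracket4 u v]; they multiply two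
    [S3 lam]-skew maps of [w], which rotate the planes of [e 1 + e 3], [e 4] and of [e 2], [e 4]. *)
Lemma canonical_curvature4E (u v w : 'rV[R]_4) :
  curvature (@bracket4 R) conn u v w =
    (u 0 0 * v 0 1 - u 0 1 * v 0 0) / 4
      *: ((lam * w 0 3) *: (@e R 1 + @e R 3) - (w 0 0 + w 0 2) *: @e R 4)
    + (u 0 0 * v 0 2 - u 0 2 * v 0 0) / 4
      *: ((lam * w 0 3) *: @e R 2 - w 0 1 *: @e R 4).
Proof.
have := canonical_connection4E; move: conn => f fE.
have curvE j : curvature (@bracket4 R) f u v w 0 j
    = f (bracket4 u v) w 0 j - f u (f v w) 0 j + f v (f u w) 0 j.
  by rewrite /curvature; move: (f _ _) (f _ _) (f _ _) => x y z; rewrite !mxE.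
by apply: rowP4; rewrite curvE !fE !bracket4E !mxE /=; field.
Qed.

(** Only v_3 contributes to the trace: v_2 is central, v_4 is killed by the curvature, and the v_1
    term vanishes because the map left by its zero coordinates kills [e 2]. *)
Lemma canonical_ricci4E (u : 'rV[R]_4) :
  ricci_operator (@bracket4 R) (S3 lam) (frame4 lam) conn u
  = ric4 u.
Proof.
have sqr_t : (Num.sqrt 2)^-1 ^+ 2 = 2^-1 :> R by rewrite exprVn sqr_sqrtr.
rewrite /ric4 /ricci_operator !big_ord_recl big_ord0 !frame4_orthonormal //=.
rewrite !canonical_curvature4E /frame4 /=.
(* With 1/4 written this way the identity holds for arbitrary values of both inverse roots, which
   can then be generalized. *)
have -> : u 0 1 / 4 = (Num.sqrt 2)^-1 ^+ 2 * u 0 1 / 2 by rewrite sqr_t; field.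
move: (Num.sqrt 2)^-1 (Num.sqrt lam)^-1 => t l.
by apply: rowP4; rewrite !mxE /=; field.
Qed.

End CanonicalConnection.

Theorem theorem3p11 (R : realType) (lam : R)
    (J : {linear 'rV[R]_4 -> 'rV[R]_4})
    (nabla : {bilinear 'rV[R]_4 -> 'rV[R]_4 -> 'rV[R]_4}) :
  0 < lam ->
  is_product_structure4 lam J ->
  is_levi_civita (@bracket4 R) (S3 lam) nabla ->
  forall c : R,
    first_kind_soliton (@bracket4 R) (S3 lam) (frame4 lam) nabla J c <-> c = 0.
Proof.
move=> lam_gt0 hJ hN c.
have ricE := canonical_ricci4E _ _ _ _ lam_gt0 hJ hN.
split=> [[D derD ricD]|->].
  have DE x : D x = ric4 x - c *: x.
    by rewrite -ricE ricD addrC addKr.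
  (* The [e 3] coordinate of the derivation rule on [[e_1, e_2] = e_3] reads [- 2c = - c]; the
     [ric4] part only adds multiples of [e 4]. *)
  have := congr1 (fun x : 'rV[R]_4 => x 0 2) (derD (e R 1) (e R 2)).
  by rewrite /= !DE /ric4 !mxE /=; lra.
by exists (@ric4 R) => [|x]; [exact: ric4_derivation | rewrite ricE scale0r add0r].
Qed.
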